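(* Let $\Sigma\subset\mathbb{R}^3$ be a translating graph. Then $\Sigma$ is $L$-stable, i.e. for every smooth compactly supported function $\eta$ on $\Sigma$, $$\int_\Sigma \eta\, L\eta\; e^{x_3}\,d\mu\leq 0 ,\qquad\text{where } L\eta=\Delta\eta+|A|^2\eta+\langle e_3,\nabla\eta\rangle .$$
   Context: Let $e_3=(0,0,1)$ and let $x_3$ denote the third coordinate. A surface $\Sigma\subset\mathbb{R}^3$ with unit normal $\upsilon$ has mean curvature $H=\operatorname{div}_\Sigma\upsilon$ (so that the first variation of the area element under a normal variation $\eta\upsilon$ is $\eta H\,d\mu$). With the paper's normalization of the speed to $C=-1$, a translating surface is a smooth surface satisfying $H+\langle e_3,\upsilon\rangle=0$. A translating graph is a translating surface that is the graph $\{(x,u(x)):x\in\Omega\}$ of a smooth function $u:\Omega\to\mathbb{R}$ over a domain $\Omega\subset\mathbb{R}^2$. On $\Sigma$ (with the metric induced from the Euclidean metric), $\Delta$ and $\nabla$ are the Laplacian and gradient, $A$ is the second fundamental form and $d\mu$ the area measure. *)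

(* Defs.v *)
From HB Require Import structures.
From mathcomp Require Import all_boot all_order all_algebra.
From mathcomp Require Import all_classical all_reals all_analysis.
Set Implicit Arguments.
Unset Strict Implicit.
Unset Printing Implicit Defensive.
Import Order.TTheory GRing.Theory Num.Theory.
Import numFieldNormedType.Exports.
Local Open Scope classical_set_scope.
Local Open Scope ring_scope.

(* The plane is R * R, which carries the product Lebesgue measure, and space is
   'rV[R]_3, whose library norm is the sup norm: Euclidean lengths are taken
   from dot.  Coordinates are numbered from 0, so x_3 is the entry 2. *)

Section Calculus.
Context {R : realType}.

Definition axis (i : 'I_2) : R * R := if i == 0 then (1, 0) else (0, 1).

Definition partial (V : normedModType R) (i : 'I_2) (f : R * R -> V)
  : R * R -> V := fun x => 'D_(axis i) f x.

(* C^oo on the open set Omega: every iterated partial derivative exists and is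
   (Frechet) differentiable at every point of Omega.  Values of f outside
   Omega are irrelevant. *)
Definition smooth_on (Omega : set (R * R)) (f : R * R -> R) :=
  forall (l : seq 'I_2) (x : R * R), Omega x ->
    differentiable (foldr (@partial R) f l) x.

Definition domain (Omega : set (R * R)) :=
  [/\ open Omega, connected Omega & Omega !=set0].

Definition dot (v w : 'rV[R]_3) : R := \sum_(k < 3) v 0 k * w 0 k.

(* The indices i + 1 and i + 2 are taken modulo 3, in the ring 'I_3. *)
Definition cross (v w : 'rV[R]_3) : 'rV[R]_3 :=
  \row_(i < 3) (v 0 (i + 1) * w 0 (i + 2) - v 0 (i + 2) * w 0 (i + 1)).

Definition e3 : 'rV[R]_3 := delta_mx 0 2.

End Calculus.

(* Geometry of a surface parametrized by X : Omega -> R^3.  A scalar or vector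
   field on the surface is represented by its pullback to the parameter
   domain, i.e. by its value at X x as a function of x. *)
Section Surface.
Context {R : realType}.
Variables (Omega : set (R * R)) (X : R * R -> 'rV[R]_3).

Definition surface : set 'rV[R]_3 := X @` Omega.

Definition metric (x : R * R) : 'M[R]_2 :=
  \matrix_(i, j) dot (partial i X x) (partial j X x).

Definition inv_metric (x : R * R) : 'M[R]_2 := invmx (metric x).

Definition area_density (x : R * R) : R := Num.sqrt (\det (metric x)).

Definition unit_normal (x : R * R) : 'rV[R]_3 :=
  let n := cross (partial 0 X x) (partial 1 X x) in
  (Num.sqrt (dot n n))^-1 *: n.

(* div_Sigma V = g^{ij} <d_i V, d_j X>, i.e. the sum of <D_{t_k} V, t_k> over
   an orthonormal tangent frame (t_k); V need not be tangent. *)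
Definition surface_div (V : R * R -> 'rV[R]_3) (x : R * R) : R :=
  \sum_(i < 2) \sum_(j < 2)
    inv_metric x i j * dot (partial i V x) (partial j X x).

Definition mean_curvature : R * R -> R := surface_div unit_normal.

(* The sign agrees with mean_curvature = trace of second_form. *)
Definition second_form (x : R * R) : 'M[R]_2 :=
  \matrix_(i, j) dot (partial i unit_normal x) (partial j X x).

(* |A|^2 = g^{ik} g^{jl} A_ij A_kl *)
Definition sqnorm_second_form (x : R * R) : R :=
  \sum_(i < 2) \sum_(j < 2) \sum_(k < 2) \sum_(l < 2)
    inv_metric x i k * inv_metric x j l * second_form x i j * second_form x k l.

Definition surface_grad (f : R * R -> R) (x : R * R) : 'rV[R]_3 :=
  \sum_(i < 2) \sum_(j < 2)
    (inv_metric x i j * partial i f x) *: partial j X x.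

Definition laplacian (f : R * R -> R) : R * R -> R :=
  surface_div (surface_grad f).

Definition stability_operator (f : R * R -> R) (x : R * R) : R :=
  laplacian f x + sqnorm_second_form x * f x + dot e3 (surface_grad f x).

(* Integral against the area measure d mu = sqrt(det g) dx. *)
Definition surface_integral (f : R * R -> R) : \bar R :=
  \int[(@lebesgue_measure R \x @lebesgue_measure R)%E]_(x in Omega)
    (f x * area_density x)%:E.

(* A function on the surface is given by any function eta on R^3 restricted to
   the surface. *)
Definition smooth_on_surface (eta : 'rV[R]_3 -> R) := smooth_on Omega (eta \o X).

Definition compactly_supported_on_surface (eta : 'rV[R]_3 -> R) :=
  exists K : set 'rV[R]_3,
    [/\ compact K, K `<=` surface &
        forall p, surface p -> ~ K p -> eta p = 0].

Definition L_stable :=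
  forall eta : 'rV[R]_3 -> R,
    smooth_on_surface eta -> compactly_supported_on_surface eta ->
    let f := eta \o X in
    (surface_integral
       (fun x => f x * stability_operator f x * expR (X x 0 2))%R <= 0)%E.

(* Unchanged if the unit normal is replaced by its opposite, as are
   sqnorm_second_form and L_stable. *)
Definition translating :=
  forall x, Omega x -> mean_curvature x + dot e3 (unit_normal x) = 0.

End Surface.

Definition graph_map {R : realType} (u : R * R -> R) (x : R * R) : 'rV[R]_3 :=
  \row_(k < 3) [:: x.1; x.2; u x]`_k.

Definition translating_graph {R : realType} (Omega : set (R * R))
    (u : R * R -> R) :=
  [/\ domain Omega, smooth_on Omega u & translating Omega (graph_map u)].

(* Main.v *)
Require Import Defs.
From mathcomp Require Import all_boot all_order all_algebra.
From mathcomp Require Import all_classical all_reals all_analysis.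
From mathcomp Require Import ring lra.

(** The operator [L] is the linearization of the translating equation, and that
    equation is preserved by vertical translations of the graph.  The normal
    component [w = <e_3, nu>] of the translation field therefore satisfies
    [L w = 0], and on a graph it is positive.  A positive solution forces
    stability: writing [eta = w phi], the weighted integral of [eta L eta]
    equals minus the weighted integral of [w^2 |grad phi|^2].

    Everything is done in the coordinates of the parameter domain.  With the
    density [weight = e^u sqrt(det g)] the drift Laplacian
    [Delta + <e_3, grad>] becomes a coordinate divergence
    ([weighted_divergence]).  The equation [L w = 0] is used in logarithmic form,
    for the covector field [d ln w] ([jacobi_tilt]); it follows from the
    translating equation and its two first derivatives by a polynomial identity,
    once mixed partial derivatives are known to commute ([derive_comm]).
    Combining the two gives pointwise
    [eta L eta weight = div Y - weight |d eta - eta d ln w|^2]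
    ([stability_identity]), where the field [Y] is supported where [eta] is.
    As [d eta - eta d ln w = w d phi], the last term is the one announced.
    The integral of [div Y] vanishes by Fubini's theorem and the fundamental
    theorem of calculus ([integral_le_divergence]). *)

Set Implicit Arguments.
Unset Strict Implicit.
Unset Printing Implicit Defensive.
Import Order.TTheory GRing.Theory Num.Theory.
Import numFieldNormedType.Exports.
Local Open Scope classical_set_scope.
Local Open Scope ring_scope.

(** * Sums and determinants in small dimension *)

Section SmallIndices.
Context {R : comNzRingType}.

Lemma ord2_cases (i : 'I_2) : i = 0 \/ i = 1.
Proof. by case: i => [[|[|]]] // ?; [left|right]; exact: val_inj. Qed.

Lemma sum_ord2 (V : zmodType) (F : 'I_2 -> V) : \sum_(i < 2) F i = F 0 + F 1.
Proof.
by rewrite !big_ord_recl big_ord0 addr0; congr (_ + F _); exact: val_inj.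
Qed.

Lemma sum_ord22 (V : zmodType) (F : 'I_2 -> 'I_2 -> V) :
  \sum_(i < 2) \sum_(j < 2) F i j = F 0 0 + F 0 1 + (F 1 0 + F 1 1).
Proof. by rewrite !sum_ord2. Qed.

Lemma sum_ord2222 (V : zmodType) (F : 'I_2 -> 'I_2 -> 'I_2 -> 'I_2 -> V) :
  let s i j := F i j 0 0 + F i j 0 1 + (F i j 1 0 + F i j 1 1) in
  \sum_(i < 2) \sum_(j < 2) \sum_(k < 2) \sum_(l < 2) F i j k l =
  s 0 0 + s 0 1 + (s 1 0 + s 1 1).
Proof. by rewrite sum_ord22 !sum_ord22. Qed.

Lemma sum_ord3 (V : zmodType) (F : 'I_3 -> V) :
  \sum_(i < 3) F i = F 0 + F 1 + F 2.
Proof.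
rewrite !big_ord_recl big_ord0 addr0 addrA.
by congr (_ + F _ + F _); exact: val_inj.
Qed.

Lemma det_ord2 (A : 'M[R]_2) : \det A = A 0 0 * A 1 1 - A 0 1 * A 1 0.
Proof.
rewrite (expand_det_row _ 0) sum_ord2 /cofactor !det_mx11 !mxE.
rewrite (_ : lift 0 0 = 1); last exact: val_inj.
rewrite (_ : lift 1 0 = 0); last exact: val_inj.
by rewrite /= !expr0 expr1; ring.
Qed.

End SmallIndices.

(** * Directional derivatives *)

Section DirectionalDerivatives.
Context {R : realType} {V : normedModType R}.
Implicit Types (f : V -> R) (v z : V).

(** Directional derivatives are one-variable derivatives along a line, which is
    how the chain rule and the mean value theorem are transferred. *)
Lemma is_derive_lineP f v z (t df : R) :
  is_derive (t *: v + z) v f df <->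
  is_derive t 1 (fun s : R => f (s *: v + z)) df.
Proof.
have E : (fun h : R => h^-1 *: (f (h *: v + (t *: v + z)) - f (t *: v + z))) =
         (fun h : R => h^-1 *: (f ((h *: (1 : R) + t) *: v + z) - f (t *: v + z))).
  apply/funext => h; congr (_ *: (f _ - _)).
  by rewrite scalerDl addrA -[h *: (1 : R)]/(h * 1) mulr1.
by split; case=> fv <-; split;
  [move: fv; rewrite /derivable /= E|rewrite /derive /= E
  |move: fv; rewrite /derivable /= E|rewrite /derive /= E].
Qed.

Lemma is_derive_comp1 (g : R -> R) f v z (df dg : R) :
  is_derive z v f df -> is_derive (f z) 1 g dg ->
  is_derive z v (g \o f) (dg * df).
Proof.
move=> fz gz.
have E : z = 0 *: v + z by rewrite scale0r add0r.
rewrite E in fz gz *; apply: (is_derive_lineP (g \o f) v z 0 _).2.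
have fl := (is_derive_lineP f v z 0 df).1 fz.
exact: (@is_derive1_comp _ g (fun s : R => f (s *: v + z)) 0 _ _ gz fl).
Qed.

Lemma mean_value_line f v z (h : R) : 0 < h ->
  (forall t, 0 <= t <= h -> derivable f (t *: v + z) v) ->
  exists2 c, 0 < c < h & f (h *: v + z) - f z = 'D_v f (c *: v + z) * h.
Proof.
move=> h0 fd.
have fl t : 0 <= t <= h ->
    is_derive t 1 (fun s : R => f (s *: v + z)) ('D_v f (t *: v + z)).
  by move=> /fd /derivableP /is_derive_lineP.
have [||c] := @MVT R (fun s : R => f (s *: v + z))
   (fun s => 'D_v f (s *: v + z)) 0 h h0.
- by move=> t; rewrite in_itv /= => /andP[t0 th]; apply: fl; rewrite !ltW.
- apply: continuous_in_subspaceT => t; rewrite inE /= in_itv /= => th.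
  by apply/differentiable_continuous/derivable1_diffP; have [] := fl _ th.
by rewrite in_itv /= subr0 scale0r add0r => ch E; exists c.
Qed.

(** Applying the mean value theorem once in each direction writes the second
    difference as [h ^+ 2] times a mixed derivative at a nearby point. *)
Lemma second_difference f v w z (U : set V) (h : R) : 0 < h ->
  (forall y, U y -> derivable f y v) ->
  (forall y, U y -> derivable ('D_v f) y w) ->
  (forall s t, 0 <= s <= h -> 0 <= t <= h -> U (s *: v + (t *: w + z))) ->
  exists s t, [/\ 0 <= s <= h, 0 <= t <= h &
    f (h *: v + (h *: w + z)) - f (h *: w + z) - (f (h *: v + z) - f z)
     = 'D_w ('D_v f) (s *: v + (t *: w + z)) * h ^+ 2].
Proof.
move=> h0 fv fvw hU.
(* The second difference is the increment of [k] from [z] to [h *: v + z]. *)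
pose k := (fun y => f (h *: w + y)) - f.
have hh : 0 <= h <= h by rewrite lexx ltW.
have shift_der t : 0 <= t <= h ->
    is_derive (t *: v + z) v (fun y => f (h *: w + y))
      ('D_v f (h *: w + (t *: v + z))).
  move=> th; apply/is_derive_lineP.
  have -> : (fun s : R => f (h *: w + (s *: v + z))) =
            (fun s : R => f (s *: v + (h *: w + z))).
    by apply/funext => s; rewrite addrCA.
  by rewrite addrCA; apply/is_derive_lineP/derivableP/fv/hU.
have U0 t : 0 <= t <= h -> U (t *: v + z).
  move=> th; have := hU t 0 th; rewrite scale0r add0r; apply.
  by rewrite lexx ltW.
have kd t : 0 <= t <= h -> is_derive (t *: v + z) v k
    ('D_v f (h *: w + (t *: v + z)) - 'D_v f (t *: v + z)).
  move=> th; apply: is_deriveB; first exact: shift_der.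
  exact/derivableP/fv/U0.
have [c /andP[c0 ch]] : exists2 c, 0 < c < h &
    k (h *: v + z) - k z = 'D_v k (c *: v + z) * h.
  by apply: mean_value_line => // t /kd[].
have cc : 0 <= c <= h by rewrite !ltW.
have -> : 'D_v k (c *: v + z) =
    'D_v f (h *: w + (c *: v + z)) - 'D_v f (c *: v + z) by have [_ ->] := kd c cc.
have [d /andP[d0 dh] ->] : exists2 d, 0 < d < h &
    'D_v f (h *: w + (c *: v + z)) - 'D_v f (c *: v + z) =
    'D_w ('D_v f) (d *: w + (c *: v + z)) * h.
  apply: (@mean_value_line ('D_v f) w (c *: v + z) h h0) => t th; apply: fvw.
  by rewrite addrCA; apply: hU.
rewrite /k !fctE => E; exists c, d; split; rewrite ?cc ?(ltW d0) ?(ltW dh) //.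
rewrite expr2 mulrA [c *: v + _]addrCA -E [h *: v + (h *: w + z)]addrCA.
ring.
Qed.

Lemma near_parallelogram v w z (P : set V) : (\forall y \near z, P y) ->
  exists2 d : R, 0 < d & forall s t, 0 <= s <= d -> 0 <= t <= d ->
    P (s *: v + (t *: w + z)).
Proof.
case/nbhs_ballP => e /= e0 eP.
pose m := `|v| + `|w| + 1.
have m0 : 0 < m by rewrite ltr_wpDl // addr_ge0.
exists (e / 2 / m); first by rewrite !divr_gt0.
move=> s t /andP[s0 sd] /andP[t0 td]; apply: eP.
rewrite -ball_normE /ball_ /= addrA opprD addrCA subrr addr0 normrN.
apply: (@le_lt_trans _ _ (e / 2)); last by rewrite ltr_pdivrMr // ltr_pMr // ltr1n.
rewrite (le_trans (ler_normD _ _)) // !normrZ !ger0_norm //.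
apply: (@le_trans _ _ (e / 2 / m * (`|v| + `|w|))).
  by rewrite mulrDr lerD // ler_wpM2r.
by rewrite -mulrA ler_piMr ?divr_ge0 ?ltW // mulrC ltr_pdivrMr // mul1r ltrDl.
Qed.

(** Both iterated derivatives are limits of the same second difference, which
    is symmetric in the two directions. *)
Lemma derive_comm f v w z :
  (\forall y \near z, [/\ derivable f y v, derivable f y w,
                          derivable ('D_v f) y w & derivable ('D_w f) y v]) ->
  {for z, continuous ('D_w ('D_v f))} -> {for z, continuous ('D_v ('D_w f))} ->
  'D_w ('D_v f) z = 'D_v ('D_w f) z.
Proof.
move=> fz cvw cwv; apply: contrapT => /eqP ne.
pose e := `|'D_w ('D_v f) z - 'D_v ('D_w f) z| / 2.
have e0 : 0 < e by rewrite divr_gt0 // normr_gt0 subr_eq0.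
have near_vw : \forall y \near z, `|'D_w ('D_v f) z - 'D_w ('D_v f) y| < e.
  by move/cvgrPdist_lt : cvw; apply.
have near_wv : \forall y \near z, `|'D_v ('D_w f) z - 'D_v ('D_w f) y| < e.
  by move/cvgrPdist_lt : cwv; apply.
have [d d0 dP] := near_parallelogram v w (filterI fz (filterI near_vw near_wv)).
have fU s t : 0 <= s <= d -> 0 <= t <= d -> _ := fun hs ht => (dP s t hs ht).1.
have [s [t [sd td Evw]]] := second_difference d0
  (fun y (Py : [/\ derivable f y v, derivable f y w,
      derivable ('D_v f) y w & derivable ('D_w f) y v]) => let: And4 a _ _ _ := Py in a)
  (fun y Py => let: And4 _ _ a _ := Py in a) fU.
have fU' s' t' : 0 <= s' <= d -> 0 <= t' <= d ->
    [/\ derivable f (s' *: w + (t' *: v + z)) v,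
        derivable f (s' *: w + (t' *: v + z)) w,
        derivable ('D_v f) (s' *: w + (t' *: v + z)) w &
        derivable ('D_w f) (s' *: w + (t' *: v + z)) v].
  by move=> hs ht; rewrite addrCA; apply: fU.
have [s' [t' [sd' td' Ewv]]] := second_difference d0
  (fun y (Py : [/\ derivable f y v, derivable f y w,
      derivable ('D_v f) y w & derivable ('D_w f) y v]) => let: And4 _ a _ _ := Py in a)
  (fun y Py => let: And4 _ _ _ a := Py in a) fU'.
have {Evw Ewv} E : 'D_w ('D_v f) (s *: v + (t *: w + z)) =
                   'D_v ('D_w f) (s' *: w + (t' *: v + z)).
  apply: (@mulIf _ (d ^+ 2)); first by rewrite expf_neq0 ?gt_eqF.
  apply: etrans (esym Evw) _; apply: etrans Ewv.
  rewrite [d *: w + (d *: v + z)]addrCA.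
  by move: (f _) (f _) (f _) (f _) => a1 a2 a3 a4; ring.
have [_ [/= vw _]] := dP s t sd td.
have [_ [/= _ wv]] := dP t' s' td' sd'.
move: wv; rewrite addrCA -E => wv.
have := ltr_leD vw (ltW wv).
rewrite -splitr ltNge => /negP; apply.
by rewrite [X in _ <= _ + X]distrC; exact: ler_distD.
Qed.

End DirectionalDerivatives.

(** * Functions of class C^n on an open set *)

Section ClassC.
Context {R : realType}.
Implicit Types (f g : R * R -> R) (n : nat) (i : 'I_2) (Om : set (R * R)).

(** Only continuity and derivatives along the axes are recorded.  This is enough
    for Schwarz's theorem and for integration along the axes, and closure under
    the algebraic operations follows from the rules for directional derivatives
    by induction on [n]. *)
Fixpoint classC Om n f : Prop :=
  (forall x, Om x -> {for x, continuous f}) /\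
  if n is n'.+1 then
    forall i, (forall x, Om x -> derivable f x (axis i)) /\
              classC Om n' (partial i f)
  else True.

Lemma classC_continuous Om n f x : classC Om n f -> Om x -> {for x, continuous f}.
Proof. by case: n => [|n] [cf _] /cf. Qed.

Lemma classC_derivable Om n f i x :
  classC Om n.+1 f -> Om x -> is_derive x (axis i) f (partial i f x).
Proof. by case=> _ /(_ i)[fd _] /fd /derivableP. Qed.

Lemma classC_partial Om n f i : classC Om n.+1 f -> classC Om n (partial i f).
Proof. by case=> _ /(_ i)[]. Qed.

Lemma classCW Om n f : classC Om n.+1 f -> classC Om n f.
Proof.
elim: n f => [|n IH] f [cf fd]; split=> // i.
by have [? ?] := fd i; split=> //; apply: IH.
Qed.

Lemma smooth_classC Om f n : smooth_on Om f -> classC Om n f.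
Proof.
elim: n f => [|n IH] f sf.
  by split=> // x /(sf [::])/differentiable_continuous.
split=> [x /(sf [::])/differentiable_continuous //|i]; split.
  by move=> x /(sf [::]) /= fx; apply: diff_derivable.
by apply: IH => l x /(sf (rcons l i)); rewrite foldr_rcons.
Qed.

Section Open.
Variables (Om : set (R * R)).
Hypothesis oOm : open Om.

Lemma near_open (P : set (R * R)) x :
  (forall y, Om y -> P y) -> Om x -> \forall y \near x, P y.
Proof. by move=> H Ox; apply: (filterS H); apply: open_nbhs_nbhs. Qed.

Lemma is_partial_eq f g i x df : (forall y, Om y -> f y = g y) -> Om x ->
  is_derive x (axis i) f df -> is_derive x (axis i) g df.
Proof. by move=> fg Ox; apply: near_eq_is_derive; exact: near_open. Qed.

Lemma partial_eq (V : normedModType R) (f g : R * R -> V) i x :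
  (forall y, Om y -> f y = g y) -> Om x -> partial i f x = partial i g x.
Proof. by move=> fg Ox; apply: near_eq_derive; exact: near_open. Qed.

Lemma classC_eq n f g :
  (forall y, Om y -> f y = g y) -> classC Om n f -> classC Om n g.
Proof.
have ceq (f' g' : R * R -> R) : (forall y, Om y -> f' y = g' y) ->
    (forall x, Om x -> {for x, continuous f'}) ->
    forall x, Om x -> {for x, continuous g'}.
  move=> fg cf x Ox; rewrite /prop_for /continuous_at -(fg x Ox).
  apply: cvg_trans (cf x Ox); apply: near_eq_cvg.
  by apply: near_open => // y /fg.
elim: n f g => [|n IH] f g fg [cf fd]; split=> //; try exact: ceq cf.
move=> i; have [dfi pf] := fd i; split.
  by move=> x Ox; have [] := is_partial_eq fg Ox (derivableP (dfi x Ox)).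
by apply: (IH _ _ _ pf) => y Oy; apply: partial_eq.
Qed.

(** The functions [d i] need only agree with the partial derivatives on [Om], so
    that they can be given by formulas that make sense only there. *)
Lemma classCS n f (d : 'I_2 -> R * R -> R) :
  (forall x, Om x -> {for x, continuous f}) ->
  (forall i x, Om x -> is_derive x (axis i) f (d i x)) ->
  (forall i, classC Om n (d i)) -> classC Om n.+1 f.
Proof.
move=> cf fd cd; split=> // i; split=> [x /(fd i)[] //|].
by apply: classC_eq (cd i) => x /(fd i)[].
Qed.

Lemma classC_cst n (a : R) : classC Om n (fun=> a).
Proof.
elim: n a => [|n IH] a; first by split=> // x _; exact: cst_continuous.
apply: (@classCS _ _ (fun _ _ => 0)) => [x _|_]; last exact: IH.
exact: cst_continuous.
Qed.

Lemma classCD n f g : classC Om n f -> classC Om n g ->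
  classC Om n (fun x => f x + g x).
Proof.
elim: n f g => [|n IH] f g cf cg.
  by split=> // x Ox; apply: continuousD; [apply: cf.1|apply: cg.1].
apply: (@classCS _ _ (fun i x => partial i f x + partial i g x)).
- by move=> x Ox; apply: continuousD; [apply: cf.1|apply: cg.1].
- move=> i x Ox.
  exact: is_deriveD (classC_derivable i cf Ox) (classC_derivable i cg Ox).
- by move=> i; apply: IH; apply: classC_partial.
Qed.

Lemma classCM n f g : classC Om n f -> classC Om n g ->
  classC Om n (fun x => f x * g x).
Proof.
elim: n f g => [|n IH] f g cf cg.
  by split=> // x Ox; apply: continuousM; [apply: cf.1|apply: cg.1].
apply: (@classCS _ _ (fun i x => f x * partial i g x + g x * partial i f x)).
- by move=> x Ox; apply: continuousM; [apply: cf.1|apply: cg.1].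
- move=> i x Ox.
  exact: is_deriveM (classC_derivable i cf Ox) (classC_derivable i cg Ox).
- by move=> i; apply: classCD; apply: IH; do ?[exact: classC_partial|exact: classCW].
Qed.

Lemma classCN n f : classC Om n f -> classC Om n (fun x => - f x).
Proof.
move=> cf; apply: classC_eq (classCM (classC_cst n (-1)) cf) => x _.
by rewrite mulN1r.
Qed.

Lemma classCB n f g : classC Om n f -> classC Om n g ->
  classC Om n (fun x => f x - g x).
Proof. by move=> cf /classCN; apply: classCD. Qed.

Lemma classCX n k f : classC Om n f -> classC Om n (fun x => f x ^+ k).
Proof.
move=> cf; elim: k => [|k IH]; first exact: classC_cst.
by apply: classC_eq (classCM cf IH) => x _; rewrite exprS.
Qed.

Lemma classC_sum2 n (F : 'I_2 -> R * R -> R) :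
  (forall i, classC Om n (F i)) -> classC Om n (fun x => \sum_(i < 2) F i x).
Proof.
move=> cF; apply: classC_eq (classCD (cF 0) (cF 1)) => x _.
by rewrite sum_ord2.
Qed.

Lemma classC_expR n f : classC Om n f -> classC Om n (expR \o f).
Proof.
elim: n => [|n IH] cf.
  by split=> // x Ox; apply: continuous_comp; [apply: cf.1|exact: continuous_expR].
apply: (@classCS _ _ (fun i x => expR (f x) * partial i f x)).
- by move=> x Ox; apply: continuous_comp; [apply: cf.1|exact: continuous_expR].
- move=> i x Ox.
  exact: is_derive_comp1 (classC_derivable i cf Ox) (is_derive_expR _).
- move=> i; apply: classCM; last exact: classC_partial.
  exact: IH (classCW cf).
Qed.

Lemma is_derive_inv_sqrt f i x df : 0 < f x -> is_derive x (axis i) f df ->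
  is_derive x (axis i) (fun y => (Num.sqrt (f y))^-1)
    (- (df / 2 * (Num.sqrt (f x))^-1 ^+ 3)).
Proof.
move=> f0 fx; have s0 : Num.sqrt (f x) != 0 by rewrite gt_eqF // sqrtr_gt0.
have sx := is_derive_comp1 fx (is_derive1_sqrt f0).
have [sd sE] := sx; split; first exact: (@derivableV _ _ (Num.sqrt \o f)).
rewrite (@deriveV _ _ (Num.sqrt \o f)) // sE /= -[X in X = _]/(_ * _).
by field.
Qed.

(** The derivative of [f^(-1/2)] is a polynomial in [f'] and [f^(-1/2)] itself,
    so the induction closes; the square root is then [f * f^(-1/2)]. *)
Lemma classC_inv_sqrt n f : (forall x, Om x -> 0 < f x) -> classC Om n f ->
  classC Om n (fun x => (Num.sqrt (f x))^-1).
Proof.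
move=> f0; have ct g : (forall x, Om x -> {for x, continuous f}) ->
    forall x, Om x -> {for x, continuous (fun x => (Num.sqrt (f x))^-1)}.
  move=> cf x Ox; apply: (@continuousV _ _ (Num.sqrt \o f)).
    by rewrite /= gt_eqF // sqrtr_gt0 f0.
  by apply: continuous_comp; [exact: cf|exact: sqrt_continuous].
elim: n => [|n IH] cf; first by split=> //; exact: ct cf.1.
apply: (@classCS _ _ (fun i x =>
  - (partial i f x / 2 * (Num.sqrt (f x))^-1 ^+ 3))).
- exact: ct cf.1.
- move=> i x Ox.
  exact: is_derive_inv_sqrt (f0 _ Ox) (classC_derivable i cf Ox).
- move=> i; apply/classCN/classCM; last exact/classCX/IH/classCW.
  by apply: (classCM _ (classC_cst _ 2^-1)); exact: classC_partial.
Qed.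

Lemma partial_comm f i j x : classC Om 2 f -> Om x ->
  partial i (partial j f) x = partial j (partial i f) x.
Proof.
move=> cf Ox; apply: derive_comm.
- apply: near_open Ox => y Oy.
  have d k : derivable f y (axis k) by have [] := classC_derivable k cf Oy.
  have dd k l : derivable (partial k f) y (axis l).
    by have [] := classC_derivable l (classC_partial k cf) Oy.
  by split; [exact: d|exact: d|exact: dd|exact: dd].
- exact: classC_continuous (classC_partial _ (classC_partial _ cf)) Ox.
- exact: classC_continuous (classC_partial _ (classC_partial _ cf)) Ox.
Qed.

End Open.
End ClassC.

(** * Integration of compactly supported functions on the plane *)

Section PlaneIntegral.
Context {R : realType}.
Local Notation leb := (@lebesgue_measure R).
Local Notation leb2 := (leb \x leb)%E.
Local Notation plane := (measurableTypeR R * measurableTypeR R)%type.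
Implicit Types (f g : R * R -> R) (i : 'I_2) (Om K : set (R * R)).

(** The product sigma-algebra contains the open sets because these are countable
    unions of boxes with rational corners. *)
Lemma open_measurable_plane (A : set (R * R)) :
  open A -> measurable (A : set plane).
Proof.
move=> oA.
pose box (q : (rat * rat) * (rat * rat)) : set (R * R) :=
  `]ratr q.1.1, ratr q.1.2[ `*` `]ratr q.2.1, ratr q.2.2[.
have -> : A = \bigcup_(q in [set q | box q `<=` A]) box q.
  rewrite eqEsubset; split => [z Az|z [q /= qA /qA //]].
  have /nbhs_ballP[e /= e0 eA] : nbhs z A by apply: open_nbhs_nbhs.
  have h (a : R) : exists q : rat * rat,
      [/\ a - e < ratr q.1, ratr q.1 < a, a < ratr q.2 & ratr q.2 < a + e].
    have [q1] : exists q, ratr q \in `]a - e, a[ by apply: rat_in_itvoo; lra.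
    have [q2] : exists q, ratr q \in `]a, a + e[ by apply: rat_in_itvoo; lra.
    rewrite !in_itv /= => /andP[? ?] /andP[? ?].
    by exists (q1, q2).
  have [[p1 p2] [/= h1 h2 h3 h4]] := h z.1.
  have [[q1 q2] [/= k1 k2 k3 k4]] := h z.2.
  exists ((p1, p2), (q1, q2)); last by split; rewrite /= in_itv /= ?h2 ?h3 ?k2 ?k3.
  move=> y [] /=; rewrite !in_itv /= => /andP[y1 y2] /andP[y3 y4]; apply: eA.
  by split; rewrite -ball_normE /ball_ /= ltr_norml; apply/andP; split; lra.
rewrite bigcup_mkcond; apply: (@countable_bigcupT_measurable _ plane) => [|q].
  exact: countableP.
case: ifPn => // _; apply: measurableX; exact: measurable_itv.
Qed.

Lemma continuous_measurable_plane f :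
  continuous f -> measurable_fun setT (f : plane -> R).
Proof.
move=> /continuousP cf; apply: (measurability _ (measurable_realfun.RGenOpens.measurableE R)).
move=> _ [_ [a [b ->] <-]]; rewrite setTI.
by apply: open_measurable_plane; apply/cf/interval_open.
Qed.

Lemma compact_in_square K : compact K ->
  exists2 M : R, 0 < M & K `<=` `[- M, M] `*` `[- M, M].
Proof.
case/compact_bounded => N [_ KN]; exists (`|N| + 1); first by rewrite ltr_wpDl.
move=> z Kz; have : `|z| <= `|N| + 1.
  by apply: KN => //; rewrite (le_lt_trans (ler_norm _)) // ltrDl.
rewrite prod_normE ge_max => /andP[].
by rewrite !ler_norml => z1 z2; split; rewrite /= in_itv.
Qed.

Lemma compact_open_compl K : compact K -> open (~` K).
Proof.
move=> cK; apply: closed_openC; apply: compact_closed cK; exact: norm_hausdorff.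
Qed.

Lemma compact_measurable_plane K : compact K -> measurable (K : set plane).
Proof.
move=> /compact_open_compl/open_measurable_plane/measurableC.
by rewrite setCK.
Qed.

Lemma compact_finite_plane K : compact K -> (leb2 K < +oo)%E.
Proof.
move=> cK; have [M M0 KM] := compact_in_square cK.
apply: (@le_lt_trans _ _ (leb2 (`[- M, M] `*` `[- M, M]))).
  apply: le_measure => //; rewrite inE; first exact: compact_measurable_plane.
  by apply: measurableX; exact: measurable_itv.
rewrite product_measure1E //= !lebesgue_measure_itv /= lte_fin.
by rewrite gtrN // -EFinB -EFinM ltry.
Qed.

Lemma continuous_compact_integrable_plane g K : continuous g -> compact K ->
  (forall x, ~ K x -> g x = 0) ->
  leb2.-integrable setT (EFin \o (g : plane -> R)).
Proof.
move=> cg cK gK.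
have mK := compact_measurable_plane cK.
suff /(integrable_mkcond _ mK) : leb2.-integrable K (EFin \o (g : plane -> R)).
  congr (leb2.-integrable _ _); apply/funext => x; rewrite patchE.
  by case: ifPn => //; rewrite notin_setE => /gK /= ->.
apply: measurable_bounded_integrable => //.
- exact: compact_finite_plane.
- by apply: measurable_funTS; exact: continuous_measurable_plane.
- have /compact_bounded[M [_ mrt]] : compact (g @` K).
    by apply: continuous_compact => //; exact: continuous_subspaceT.
  by exists M; split; rewrite ?num_real // => ? ? ? ?; exact: mrt.
Qed.

Definition vanishes_off K f := forall x, ~ K x -> f x = 0.

Lemma partial0 (U : set (R * R)) f i x : open U -> (forall y, U y -> f y = 0) ->
  U x -> partial i f x = 0.
Proof.
move=> oU f0 Ux; rewrite (partial_eq (g := fun=> 0) oU i f0 Ux).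
exact: derive_cst.
Qed.

Lemma vanishes_off_partial K f i : compact K -> vanishes_off K f ->
  vanishes_off K (partial i f).
Proof. by move=> cK fK x nKx; apply: (partial0 i (compact_open_compl cK) fK nKx). Qed.

Definition extend0 Om f : R * R -> R := patch (fun=> 0) Om f.

Section Extension.
Variables (Om K : set (R * R)).
Hypotheses (oOm : open Om) (cK : compact K) (KOm : K `<=` Om).

Lemma extend0_partial f i : (forall x, Om x -> ~ K x -> f x = 0) ->
  extend0 Om (partial i f) = partial i (extend0 Om f).
Proof.
move=> fK; apply/funext => x; rewrite /extend0 patchE; case: ifPn => [|].
  rewrite inE => Ox; apply: partial_eq Ox => // y Oy.
  by rewrite patchE mem_set.
rewrite notin_setE => nOx; apply/esym; apply: (@partial0 (~` K)).
- exact: compact_open_compl.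
- move=> y nKy; rewrite patchE; case: ifPn => //; rewrite inE => Oy; exact: fK.
- by move=> /KOm.
Qed.

(** A function that is C^n on [Om] and vanishes outside a compact subset stays
    C^n when continued by zero: near every point one of the two formulas holds
    on a neighbourhood. *)
Lemma classC_extend0 n f : (forall x, Om x -> ~ K x -> f x = 0) ->
  classC Om n f -> classC setT n (extend0 Om f).
Proof.
have cont0 (U : set (R * R)) (g h : R * R -> R) x : open U -> U x ->
    (forall y, U y -> h y = g y) -> {for x, continuous g} -> {for x, continuous h}.
  move=> oU Ux gh; rewrite /prop_for /continuous_at -(gh x Ux); apply: cvg_trans.
  apply: near_eq_cvg; apply: (near_open oU _ Ux) => y Uy.
  by rewrite gh.
have cextE g : (forall x, Om x -> ~ K x -> g x = 0) ->
    (forall x, Om x -> {for x, continuous g}) ->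
    forall x, setT x -> {for x, continuous (extend0 Om g)}.
  move=> gK cg x _; have [Ox|nOx] := pselect (Om x).
    apply: (cont0 _ _ _ _ oOm Ox) (cg _ Ox) => y Oy.
    by rewrite /extend0 patchE mem_set.
  apply: (cont0 _ (fun=> 0) _ _ (compact_open_compl cK)).
  - by move=> /KOm.
  - by move=> y nKy; rewrite /extend0 patchE; case: ifPn => //; rewrite inE => /gK ->.
  - exact: cst_continuous.
elim: n f => [|n IH] f fK [cf df]; split=> //; try exact: cextE.
move=> i; have [dfi pf] := df i; split; last first.
  rewrite -extend0_partial //; apply: IH pf => x Ox nKx.
  apply: (@partial0 (Om `&` ~` K)) => //.
  - by apply: openI => //; exact: compact_open_compl.
  - by move=> y [Oy nKy]; exact: fK.
move=> x _; have [Ox|nOx] := pselect (Om x).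
  have [] // := is_partial_eq (g := extend0 Om f) oOm _ Ox (derivableP (dfi x Ox)).
  by move=> y Oy; rewrite /extend0 patchE mem_set.
have [] // := is_partial_eq (f := fun=> 0) (g := extend0 Om f) (x := x)
  (compact_open_compl cK) _ _ (is_derive_cst 0 x (axis i)).
  by move=> y nKy; rewrite /extend0 patchE; case: ifPn => //; rewrite inE => /fK ->.
by move=> /KOm.
Qed.

End Extension.

(** By the fundamental theorem of calculus on an interval whose endpoints lie
    outside the support. *)
Lemma integral_derive_compact (g dg : R -> R) (M : R) : 0 < M ->
  (forall x : R, is_derive x 1 g (dg x)) -> continuous dg ->
  (forall x, M < `|x| -> g x = 0) -> (forall x, M < `|x| -> dg x = 0) ->
  (\int[leb]_x (dg x)%:E = 0)%E.
Proof.
move=> M0 gd cdg g0 dg0.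
have cg : continuous g.
  by move=> x; apply/differentiable_continuous/derivable1_diffP; have [] := gd x.
have -> : (\int[leb]_x (dg x)%:E = \int[leb]_(x in `[(- (M + 1))%R, (M + 1)%R]) (dg x)%:E)%E.
  rewrite [RHS]integral_mkcond; apply: eq_integral => x _.
  rewrite patchE; case: ifPn => //; rewrite notin_setE /= in_itv /= => /negP.
  rewrite -ler_norml -ltNge => Mx; rewrite dg0 //.
  by apply: lt_trans Mx; rewrite ltrDl.
rewrite (@continuous_FTC2 R dg g).
- rewrite !g0 ?subee // ?normrN ger0_norm ?ltrDl //; lra.
- lra.
- exact: continuous_subspaceT.
- split=> [x _|//|//].
  + by have [] := gd x.
  + exact/cvg_at_right_filter/cg.
  + exact/cvg_at_left_filter/cg.
- by move=> x _; rewrite derive1E; have [_ ->] := gd x.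
Qed.

(** Fubini's theorem, integrating first in the direction of the derivative. *)
Lemma integral_partial_compact f K i : classC setT 1 f -> compact K ->
  vanishes_off K f -> (\int[leb2]_x (partial i f x)%:E = 0)%E.
Proof.
move=> cf cK fK.
have pK := vanishes_off_partial i cK fK.
have cp : continuous (partial i f).
  by move=> x; apply: (classC_continuous (classC_partial i cf)).
have ip := continuous_compact_integrable_plane cp cK pK.
have [M M0 KM] := compact_in_square cK.
have off (h : R * R -> R) : vanishes_off K h ->
    forall x y, M < `|x| \/ M < `|y| -> h (x, y) = 0.
  move=> hK x y xy; apply: hK => /KM[] /=; rewrite !in_itv /= -!ler_norml.
  by case: xy; rewrite ltNge => /negP.
have lineE (x y : R) : (x *: axis 0 + (0, y) = (x, y)) * (y *: axis 1 + (x, 0) = (x, y)).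
  by rewrite /axis; split; congr pair; rewrite /= ?addr0 ?scaler0 ?add0r //;
    exact: mulr1.
case: (ord2_cases i) => ei; rewrite ei {ei i} in pK cp ip *.
  rewrite -(integral21_prod_meas1 (f := EFin \o (partial 0 f : plane -> R))) //.
  suff inner (y : R) : (\int[leb]_x (partial 0 f (x, y))%:E = 0)%E.
    by rewrite integral0_eq // => y _; exact: inner.
  apply: (@integral_derive_compact (fun x => f (x, y)) _ M) => //.
  - move=> x; have -> : (fun x => f (x, y)) = (fun s : R => f (s *: axis 0 + (0, y))).
      by apply/funext => s; rewrite lineE.
    apply: (is_derive_lineP f (axis 0) (0, y) x _).1; rewrite lineE.
    exact: (@classC_derivable R setT 0 f 0 (x, y) cf I).
  - move=> x; apply: (@continuous_comp R (R * R)%type R (fun x => (x, y)) (partial 0 f)).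
      exact: (cvg_pair cvg_id (cvg_cst y)).
    exact: cp.
  - by move=> x Mx; apply: off => //; left.
  - by move=> x Mx; apply: off => //; left.
rewrite -(integral12_prod_meas1 (f := EFin \o (partial 1 f : plane -> R))) //.
suff inner (x : R) : (\int[leb]_y (partial 1 f (x, y))%:E = 0)%E.
  by rewrite integral0_eq // => x _; exact: inner.
apply: (@integral_derive_compact (fun y => f (x, y)) _ M) => //.
- move=> y; have -> : (fun y => f (x, y)) = (fun s : R => f (s *: axis 1 + (x, 0))).
    by apply/funext => s; rewrite lineE.
  apply: (is_derive_lineP f (axis 1) (x, 0) y _).1; rewrite lineE.
  exact: (@classC_derivable R setT 0 f 1 (x, y) cf I).
- move=> y; apply: (@continuous_comp R (R * R)%type R (fun y => (x, y)) (partial 1 f)).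
    exact: (cvg_pair (cvg_cst x) cvg_id).
  exact: cp.
- by move=> y My; apply: off => //; right.
- by move=> y My; apply: off => //; right.
Qed.

(** The right-hand side of the pointwise bound is the divergence of a compactly
    supported field, whose integral over [Om] vanishes after continuation of the
    field by zero to the whole plane. *)
Lemma integral_le_divergence (Om K : set (R * R)) (Y : 'I_2 -> R * R -> R) g :
  open Om -> compact K -> K `<=` Om ->
  (forall i, classC Om 1 (Y i)) ->
  (forall i x, Om x -> ~ K x -> Y i x = 0) ->
  (forall x, Om x -> ~ K x -> g x = 0) ->
  classC Om 0 g ->
  (forall x, Om x -> g x <= \sum_(i < 2) partial i (Y i) x) ->
  (\int[leb2]_(x in Om) (g x)%:E <= 0)%E.
Proof.
move=> oOm cK KOm cY YK gK cg gle.
pose ext f := extend0 Om f.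
have extK f : (forall x, Om x -> ~ K x -> f x = 0) -> vanishes_off K (ext f).
  by move=> fK x nKx; rewrite /ext /extend0 patchE; case: ifPn => //; rewrite inE => /fK ->.
have cext : classC setT 0 (ext g) by apply: (@classC_extend0 Om K).
have cYext i : classC setT 1 (ext (Y i)) by apply: (@classC_extend0 Om K) => // x; exact: YK.
have ig : leb2.-integrable setT (EFin \o (ext g : plane -> R)).
  apply: (continuous_compact_integrable_plane _ cK (extK _ gK)) => x.
  exact: cext.1.
have iY i : leb2.-integrable setT (EFin \o (partial i (ext (Y i)) : plane -> R)).
  apply: (continuous_compact_integrable_plane _ cK).
    by move=> x; apply: (classC_continuous (classC_partial i (cYext i))).
  by apply: vanishes_off_partial => //; apply: extK => x; exact: YK.
rewrite integral_mkcond.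
have -> : (fun x => (g x)%:E) \_ Om = EFin \o (ext g : plane -> R).
  by apply/funext => x; rewrite /ext /extend0 /= !patchE; case: ifP.
apply: (@le_trans _ _ (\int[leb2]_x ((partial 0 (ext (Y 0)) x)%:E
                                   + (partial 1 (ext (Y 1)) x)%:E))%E).
  apply: le_integral => //; first by apply: (integrableD _ (iY 0) (iY 1)).
  move=> x _; rewrite /= -EFinD lee_fin.
  rewrite -!(extend0_partial oOm cK KOm); [|exact: YK|exact: YK].
  rewrite /ext /extend0 !patchE; case: ifPn; last by rewrite addr0.
  by rewrite inE => /gle; rewrite sum_ord2.
rewrite integralD //; last 2 first.
- exact: iY.
- exact: iY.
rewrite !(integral_partial_compact _ _ cK) ?addr0 // ?adde0 //.
- by apply: extK => x; exact: YK.
- by apply: extK => x; exact: YK.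
Qed.

End PlaneIntegral.

(** * Geometry of a graph *)

Section PartialRules.
Context {R : realType}.
Implicit Types (f g : R * R -> R) (v x : R * R).

Lemma is_derive_change f v x (d d' : R) :
  is_derive x v f d -> d = d' -> is_derive x v f d'.
Proof. by move=> fx <-. Qed.

Lemma is_partialE f (i : 'I_2) x (d : R) :
  is_derive x (axis i) f d -> partial i f x = d.
Proof. by case. Qed.

Lemma is_derive_add f g v x (df dg : R) :
  is_derive x v f df -> is_derive x v g dg ->
  is_derive x v (fun y => f y + g y) (df + dg).
Proof. exact: is_deriveD. Qed.

Lemma is_derive_opp f v x (df : R) :
  is_derive x v f df -> is_derive x v (fun y => - f y) (- df).
Proof. exact: is_deriveN. Qed.

Lemma is_derive_mul f g v x (df dg : R) :
  is_derive x v f df -> is_derive x v g dg ->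
  is_derive x v (fun y => f y * g y) (f x * dg + g x * df).
Proof. exact: is_deriveM. Qed.

Lemma is_derive_sqr f v x (df : R) :
  is_derive x v f df -> is_derive x v (fun y => f y ^+ 2) (2 * f x * df).
Proof.
move=> fx; under eq_fun do rewrite expr2.
by apply: (is_derive_change (is_derive_mul fx fx)); ring.
Qed.

Lemma is_derive_inv f v x (df : R) : f x != 0 ->
  is_derive x v f df -> is_derive x v (fun y => (f y)^-1) (- df / f x ^+ 2).
Proof.
move=> fx0 [fd fE]; split; first exact: (derivableV fx0 fd).
by rewrite (deriveV fx0 fd) fE -[X in X = _]/(_ * _); field.
Qed.

Lemma is_derive_const (a : R) v x : is_derive x v (fun=> a) 0.
Proof. exact: is_derive_cst. Qed.

Lemma is_derive_fst v x : is_derive x v (fun y : R * R => y.1) v.1.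
Proof.
rewrite -[x](add0r x) -[X in X + x](scale0r v).
apply/(is_derive_lineP (fun y : R * R => y.1)).
rewrite (_ : (fun s : R => _) = (fun s : R => s * v.1 + x.1)) //.
apply: is_derive_eq; rewrite /=.
by rewrite addr0 -[X in _ + X]/(_ * _) mulr1 -[X in X + _]/(_ * _) mulr0 add0r.
Qed.

Lemma is_derive_snd v x : is_derive x v (fun y : R * R => y.2) v.2.
Proof.
rewrite -[x](add0r x) -[X in X + x](scale0r v).
apply/(is_derive_lineP (fun y : R * R => y.2)).
rewrite (_ : (fun s : R => _) = (fun s : R => s * v.2 + x.2)) //.
apply: is_derive_eq; rewrite /=.
by rewrite addr0 -[X in _ + X]/(_ * _) mulr1 -[X in X + _]/(_ * _) mulr0 add0r.
Qed.

Lemma partial_row (F : 'I_3 -> R * R -> R) (dF : 'I_3 -> R) (i : 'I_2) x :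
  (forall k, is_derive x (axis i) (F k) (dF k)) ->
  partial i (fun y => \row_k F k y) x = \row_k dF k.
Proof.
move=> FdF; rewrite [LHS]derive_mx; last first.
  apply/derivable_mxP => a k; have [Fd _] := FdF k.
  by under eq_fun do rewrite mxE.
apply/rowP => k; rewrite !mxE; have [_ <-] := FdF k.
suff -> : (fun y => (\row_k F k y) 0 k) = F k by [].
by apply/funext => y; rewrite mxE.
Qed.

End PartialRules.

(* Computes the directional derivative of a polynomial expression in functions
   whose derivatives are in the context.  The hypotheses are recognized
   syntactically, since unfolding derivatives to limits makes the comparison of
   two different functions very slow. *)
Ltac derive_poly :=
  match goal with
  | H : is_derive _ _ ?f _ |- is_derive _ _ ?g _ => constr_eq f g; exact H
  | H : is_derive _ _ ?f _ |- is_derive _ _ (fun y => ?g y) _ =>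
      constr_eq f g; exact H
  | |- is_derive _ _ (fun y => @?f y + @?g y) _ =>
      eapply (@is_derive_add _ f g); derive_poly
  | |- is_derive _ _ (fun y => - @?f y) _ =>
      eapply (@is_derive_opp _ f); derive_poly
  | |- is_derive _ _ (fun y => @?f y ^+ 2) _ =>
      eapply (@is_derive_sqr _ f); derive_poly
  | |- is_derive _ _ (fun y => @?f y * @?g y) _ =>
      eapply (@is_derive_mul _ f g); derive_poly
  | |- is_derive _ _ (fun _ => ?c) _ => eapply (@is_derive_const _ c)
  end.

(* Turns the values of partial derivatives into variables, so that the algebra
   tactics do not try to unify one limit with another. *)
Ltac partials_to_vars :=
  repeat match goal with
  | |- context [partial ?i ?f ?x] =>
      let d := fresh "d" in generalize (partial i f x); intro d
  end.

Section GraphGeometry.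
Context {R : realType}.
Variables (Om : set (R * R)) (u : R * R -> R).
Hypotheses (oOm : open Om) (Cu : forall n, classC Om n u).
Local Notation X := (graph_map u).
Local Notation p := (partial 0 u).
Local Notation q := (partial 1 u).
Implicit Types (i j : 'I_2) (x : R * R).

(** The determinant of the metric that the graph inherits from space. *)
Definition graph_det x : R := 1 + p x ^+ 2 + q x ^+ 2.

Lemma graph_det_gt0 x : 0 < graph_det x.
Proof. by rewrite /graph_det -addrA ltr_pwDl // addr_ge0 // sqr_ge0. Qed.

Lemma graph_det_neq0 x : graph_det x != 0. Proof. by rewrite gt_eqF // graph_det_gt0. Qed.

Lemma partial_graph i x : Om x ->
  partial i X x = \row_k [:: (axis i).1; (axis i).2; partial i u x]`_k.
Proof.
move=> Ox.
apply: (@partial_row _ (fun k y => [:: y.1; y.2; u y]`_k)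
  (fun k => [:: (axis i).1; (axis i).2; partial i u x]`_k)).
case=> [[|[|[|//]]]] lt /=.
- exact: is_derive_fst.
- exact: is_derive_snd.
- exact: classC_derivable (Cu 1) Ox.
Qed.

Lemma dot_row (a b c a' b' c' : R) :
  dot (\row_k [:: a; b; c]`_k) (\row_k [:: a'; b'; c']`_k) = a * a' + b * b' + c * c'.
Proof. by rewrite /dot sum_ord3 !mxE. Qed.

Lemma dot_e3_row (a b c : R) : dot e3 (\row_k [:: a; b; c]`_k) = c.
Proof. by rewrite /dot sum_ord3 /e3 !mxE /= !mul0r mul1r !add0r. Qed.

Lemma metric_graph i j x : Om x ->
  metric X x i j = (i == j)%:R + partial i u x * partial j u x.
Proof.
move=> Ox; rewrite mxE !partial_graph // dot_row /axis.
by case: (ord2_cases i) => ->; case: (ord2_cases j) => -> /=;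
  partials_to_vars; ring.
Qed.

(** The inverse of the metric [1 + Du^T Du], by the Sherman-Morrison formula. *)
Definition cometric i j x : R :=
  (i == j)%:R - partial i u x * partial j u x * (graph_det x)^-1.

Lemma inv_metric_graph i j x : Om x -> inv_metric X x i j = cometric i j x.
Proof.
move=> Ox; have W0 := graph_det_neq0 x.
pose B : 'M[R]_2 := \matrix_(i, j) cometric i j x.
have AB : metric X x *m B = 1%:M.
  apply/matrixP => a b; rewrite mxE sum_ord2 !metric_graph // !mxE /cometric.
  move: W0; rewrite /graph_det.
  by case: (ord2_cases a) => ->; case: (ord2_cases b) => -> /=;
    partials_to_vars => W0; field.
have -> : inv_metric X x = B.
  by rewrite /inv_metric -[RHS](mulKmx (mulmx1_unit AB).1) AB mulmx1.
by rewrite mxE.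
Qed.

Lemma area_density_graph x : Om x -> area_density X x = Num.sqrt (graph_det x).
Proof.
move=> Ox; rewrite /area_density det_ord2 !metric_graph //; congr Num.sqrt.
by rewrite /graph_det /=; partials_to_vars; ring.
Qed.

(** The vertical component [<e_3, nu>] of the unit normal. *)
Definition tilt x : R := (Num.sqrt (graph_det x))^-1.

Lemma tilt_gt0 x : 0 < tilt x.
Proof. by rewrite invr_gt0 sqrtr_gt0 graph_det_gt0. Qed.

Lemma tilt_sqr x : tilt x ^+ 2 = (graph_det x)^-1.
Proof. by rewrite exprVn sqr_sqrtr // ltW // graph_det_gt0. Qed.

Lemma unit_normal_graph x : Om x ->
  unit_normal X x = \row_k [:: - (p x * tilt x); - (q x * tilt x); tilt x]`_k.
Proof.
move=> Ox.
have nE : cross (partial 0 X x) (partial 1 X x) = \row_k [:: - p x; - q x; 1]`_k.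
  transitivity (cross (\row_(k < 3) [:: 1; 0; p x]`_k) (\row_(k < 3) [:: 0; 1; q x]`_k)).
    by congr cross; rewrite partial_graph.
  move: (p x) (q x) => a b; apply/rowP => k; rewrite !mxE.
  by case: k => [[|[|[|?]]]] lt //=; ring.
rewrite /unit_normal nE dot_row.
have -> : - p x * - p x + - q x * - q x + 1 * 1 = graph_det x.
  by rewrite /graph_det; partials_to_vars; ring.
apply/rowP => k; rewrite !mxE /tilt.
by case: k => [[|[|[|?]]]] lt //=; partials_to_vars; ring.
Qed.

Lemma is_derive_graph_det i x : Om x -> is_derive x (axis i) graph_det
  (2 * (p x * partial i p x + q x * partial i q x)).
Proof.
move=> Ox.
have dp := classC_derivable i (classC_partial 0 (Cu 2)) Ox.
have dq := classC_derivable i (classC_partial 1 (Cu 2)) Ox.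
eapply is_derive_change; first by rewrite /graph_det; derive_poly.
by partials_to_vars; ring.
Qed.

Lemma is_derive_tilt i x : Om x -> is_derive x (axis i) tilt
  (- ((p x * partial i p x + q x * partial i q x) * tilt x ^+ 3)).
Proof.
move=> Ox.
apply: (is_derive_change (is_derive_inv_sqrt (graph_det_gt0 x) (is_derive_graph_det i Ox))).
by partials_to_vars; rewrite /tilt; move: (Num.sqrt _)^-1 => w; field.
Qed.

(** As [nu] is orthogonal to the tangent vector [X_j], the entry [<nu_i, X_j>] is
    [- <nu, X_ij>], and [X_ij] is vertical with height [u_ij]. *)
Lemma second_form_graph i j x : Om x ->
  second_form X x i j = - (partial i (partial j u) x * tilt x).
Proof.
move=> Ox; rewrite mxE.
rewrite (partial_eq oOm i unit_normal_graph Ox).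
have dp := classC_derivable i (classC_partial 0 (Cu 2)) Ox.
have dq := classC_derivable i (classC_partial 1 (Cu 2)) Ox.
have dw := is_derive_tilt i Ox.
set dtilt := - _ in dw.
pose nu (k : 'I_3) y := [:: - (p y * tilt y); - (q y * tilt y); tilt y]`_k.
pose dnu (k : 'I_3) := [:: - (p x * dtilt + tilt x * partial i p x);
  - (q x * dtilt + tilt x * partial i q x); dtilt]`_k.
have dnuP k : is_derive x (axis i) (nu k) (dnu k).
  by case: k => [[|[|[|?]]]] lt //; rewrite /nu /dnu /=; derive_poly.
rewrite (partial_row dnuP) /dnu.
rewrite partial_graph // dot_row /axis /dtilt; move: (tilt x) => w.
by case: (ord2_cases j) => -> /=; partials_to_vars; ring.
Qed.

End GraphGeometry.

(** * The translating equation and the weighted divergence *)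

Section WeightedDivergence.
Context {R : realType}.
Variables (Om : set (R * R)) (u : R * R -> R).
Hypotheses (oOm : open Om) (Cu : forall n, classC Om n u).
Local Notation X := (graph_map u).
Local Notation p := (partial 0 u).
Local Notation q := (partial 1 u).
Implicit Types (i j : 'I_2) (x : R * R).

(** The equation [H + <e_3, nu> = 0], cleared of denominators. *)
Lemma translating_equation x : translating Om X -> Om x ->
  (1 + q x ^+ 2) * partial 0 p x - p x * q x * (partial 0 q x + partial 1 p x)
    + (1 + p x ^+ 2) * partial 1 q x = graph_det u x.
Proof.
move=> tr Ox; have := tr x Ox.
have -> : mean_curvature X x = \sum_(i < 2) \sum_(j < 2)
    cometric u i j x * - (partial i (partial j u) x * tilt u x).
  apply: eq_bigr => i _; apply: eq_bigr => j _; congr (_ * _).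
    exact: (inv_metric_graph Cu).
  by rewrite -(second_form_graph oOm Cu) // mxE.
rewrite (unit_normal_graph Cu Ox) dot_e3_row sum_ord22.
move: (tilt_gt0 u x) (graph_det_neq0 u x); rewrite /cometric /graph_det /=.
generalize (tilt u x) (p x) (q x) (partial 0 p x) (partial 0 q x)
  (partial 1 p x) (partial 1 q x) => w a b r s1 s2 t w0 g0 E.
(* [E] says that the difference of the two sides of the goal, multiplied by [- w]
   and divided by the determinant of the metric, is zero. *)
apply: (mulIf (lt0r_neq0 w0)); apply/eqP; rewrite -subr_eq0 -oppr_eq0; apply/eqP.
rewrite -[RHS](mulr0 (1 + a ^+ 2 + b ^+ 2)) -E.
by field.
Qed.

(** The density of [e^(x_3) d mu] with respect to Lebesgue measure. *)
Definition weight x : R := expR (u x) * Num.sqrt (graph_det u x).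

Lemma is_derive_weight i x : Om x -> is_derive x (axis i) weight
  (weight x * (partial i u x +
     (p x * partial i p x + q x * partial i q x) * (graph_det u x)^-1)).
Proof.
move=> Ox.
have du := is_derive_comp1 (classC_derivable i (Cu 1) Ox) (is_derive_expR _).
have ds := is_derive_comp1 (is_derive_graph_det Cu i Ox) (is_derive1_sqrt (graph_det_gt0 u x)).
apply: (is_derive_change (is_derive_mul du ds)).
have s0 : Num.sqrt (graph_det u x) != 0 by rewrite gt_eqF // sqrtr_gt0 graph_det_gt0.
rewrite /weight -tilt_sqr /tilt /=.
move: (Num.sqrt _) s0 (expR _) => s s0 e; partials_to_vars.
by field.
Qed.

(** In coordinates the divergence of a tangent field is
    [sqrt(det g)^-1 d_i (sqrt(det g) V^i)], and differentiating the factor [e^u]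
    of the weight produces [<e_3, F>], as the vertical component of [F] is
    [V^i u_i]. *)
Lemma weighted_divergence (V : 'I_2 -> R * R -> R) (F : R * R -> 'rV[R]_3) x :
  (forall i, classC Om 1 (V i)) ->
  (forall y, Om y ->
     F y = \row_k [:: V 0 y; V 1 y; p y * V 0 y + q y * V 1 y]`_k) ->
  Om x ->
  \sum_(i < 2) partial i (fun y => weight y * V i y) x
  = weight x * (surface_div X F x + dot e3 (F x)).
Proof.
move=> CV FE Ox.
have dV0 i := classC_derivable i (CV 0) Ox.
have dV1 i := classC_derivable i (CV 1) Ox.
have dp i := classC_derivable i (classC_partial 0 (Cu 2)) Ox.
have dq i := classC_derivable i (classC_partial 1 (Cu 2)) Ox.
have E0 := is_partialE (is_derive_mul (is_derive_weight 0 Ox) (dV0 0)).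
have E1 := is_partialE (is_derive_mul (is_derive_weight 1 Ox) (dV1 1)).
rewrite sum_ord2; apply: etrans (congr2 +%R E0 E1) _ => {E0 E1}.
pose f (k : 'I_3) y := [:: V 0 y; V 1 y; p y * V 0 y + q y * V 1 y]`_k.
pose df i (k : 'I_3) := [:: partial i (V 0) x; partial i (V 1) x;
  (p x * partial i (V 0) x + V 0 x * partial i p x) +
  (q x * partial i (V 1) x + V 1 x * partial i q x)]`_k.
have fP i k : is_derive x (axis i) (f k) (df i k).
  have := dp i; have := dq i; have := dV0 i; have := dV1 i => *.
  by case: k => [[|[|[|?]]]] lt //; rewrite /f /df /=; derive_poly.
have partialF i : partial i F x = \row_k df i k.
  rewrite -(partial_row (fP i)).
  exact: (partial_eq oOm).
have -> : surface_div X F x = \sum_(i < 2) \sum_(j < 2) cometric u i j x *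
    (partial i (V 0) x * (axis j).1 + partial i (V 1) x * (axis j).2 +
     ((p x * partial i (V 0) x + V 0 x * partial i p x) +
      (q x * partial i (V 1) x + V 1 x * partial i q x)) * partial j u x).
  apply: eq_bigr => i _; apply: eq_bigr => j _; rewrite -dot_row.
  congr (_ * dot _ _); first exact: (inv_metric_graph Cu).
    exact: partialF.
  exact: (partial_graph Cu).
rewrite (FE x Ox) dot_e3_row sum_ord22 /cometric /axis /=.
have W0 := graph_det_neq0 u x; move: W0; rewrite /graph_det /=.
move: (weight x) => w.
rewrite (partial_comm oOm 0 1 (Cu 2) Ox).
partials_to_vars => W0.
by field.
Qed.

End WeightedDivergence.

(** * The Jacobi field of vertical translations *)

Section TiltJacobiField.
Context {R : realType}.
Variables (Om : set (R * R)) (u : R * R -> R).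
Hypotheses (oOm : open Om) (Cu : forall n, classC Om n u).
Local Notation X := (graph_map u).
Local Notation p := (partial 0 u).
Local Notation q := (partial 1 u).
Implicit Types (i j : 'I_2) (x : R * R).
Hypothesis tr : translating Om X.

(** Differentiating the translating equation gives the relations between the third
    derivatives of [u] that make [tilt] a solution of the linearized equation. *)
Lemma derived_translating_equation i x : Om x ->
  2 * q x * partial i q x * partial 0 p x
    + (1 + q x ^+ 2) * partial i (partial 0 p) x
    - (partial i p x * q x + p x * partial i q x)
        * (partial 0 q x + partial 1 p x)
    - p x * q x * (partial i (partial 0 q) x + partial i (partial 1 p) x)
    + 2 * p x * partial i p x * partial 1 q x
    + (1 + p x ^+ 2) * partial i (partial 1 q) x
  = 2 * (p x * partial i p x + q x * partial i q x).
Proof.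
move=> Ox.
have C k l : classC Om 1 (partial k (partial l u)).
  by do 2 apply: classC_partial.
have dp := classC_derivable i (classC_partial 0 (Cu 2)) Ox.
have dq := classC_derivable i (classC_partial 1 (Cu 2)) Ox.
have d00 := classC_derivable i (C 0 0) Ox.
have d01 := classC_derivable i (C 0 1) Ox.
have d10 := classC_derivable i (C 1 0) Ox.
have d11 := classC_derivable i (C 1 1) Ox.
have dg := is_derive_graph_det Cu i Ox.
apply: etrans (is_partialE dg).
apply: etrans (partial_eq oOm i (fun y Oy => translating_equation oOm Cu tr Oy) Ox).
apply: esym; eapply is_partialE; eapply is_derive_change; first by derive_poly.
by partials_to_vars; ring.
Qed.

(** The covector [d ln w] for [w = tilt u]. *)
Definition dlntilt j x : R :=
  - ((p x * partial j p x + q x * partial j q x) * (graph_det u x)^-1).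

(** The tangent vector dual to the covector [xi]: its components are
    [g^ij xi_j]. *)
Definition raise (xi : 'I_2 -> R * R -> R) i x : R :=
  xi i x - partial i u x * (p x * xi 0 x + q x * xi 1 x) * (graph_det u x)^-1.

Definition sqnorm_covector (xi : 'I_2 -> R * R -> R) x : R :=
  \sum_(i < 2) raise xi i x * xi i x.

Lemma sqnorm_second_form_graph x : Om x ->
  sqnorm_second_form X x =
  (graph_det u x)^-1 * \sum_(i < 2) \sum_(j < 2) \sum_(k < 2) \sum_(l < 2)
    cometric u i k x * cometric u j l x *
    partial i (partial j u) x * partial k (partial l u) x.
Proof.
move=> Ox; rewrite mulr_sumr; apply: eq_bigr => i _.
rewrite mulr_sumr; apply: eq_bigr => j _.
rewrite mulr_sumr; apply: eq_bigr => k _.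
rewrite mulr_sumr; apply: eq_bigr => l _.
rewrite !(inv_metric_graph Cu _ _ Ox) !(second_form_graph oOm Cu _ _ Ox) -tilt_sqr.
move: (tilt u x) (cometric u i k x) (cometric u j l x) => t c1 c2.
by partials_to_vars; ring.
Qed.

(** This is [L w = 0] for [w = tilt u], divided by [w]: in general
    [(Delta w + <e_3, grad w>) / w] equals [|d ln w|^2] plus the weighted
    divergence of [grad ln w]. *)
Lemma jacobi_tilt x : Om x ->
  \sum_(i < 2) partial i (fun y => weight u y * raise dlntilt i y) x =
  - (weight u x * (sqnorm_second_form X x + sqnorm_covector dlntilt x)).
Proof.
move=> Ox.
have C k l : classC Om 1 (partial k (partial l u)).
  by do 2 apply: classC_partial.
have dN i : is_derive x (axis i) (fun y => (graph_det u y)^-1)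
   (- (2 * (p x * partial i p x + q x * partial i q x)) / graph_det u x ^+ 2).
  by apply: is_derive_inv; [exact: graph_det_neq0|exact: is_derive_graph_det].
eassert (dV0 : is_derive x (axis 0) (fun y => weight u y * raise dlntilt 0 y) _).
  have dw := is_derive_weight Cu 0 Ox.
  have dn := dN 0.
  have dp := classC_derivable 0 (classC_partial 0 (Cu 2)) Ox.
  have dq := classC_derivable 0 (classC_partial 1 (Cu 2)) Ox.
  have d00 := classC_derivable 0 (C 0 0) Ox.
  have d01 := classC_derivable 0 (C 0 1) Ox.
  have d10 := classC_derivable 0 (C 1 0) Ox.
  have d11 := classC_derivable 0 (C 1 1) Ox.
  by rewrite /raise /dlntilt; derive_poly.
eassert (dV1 : is_derive x (axis 1) (fun y => weight u y * raise dlntilt 1 y) _).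
  have dw := is_derive_weight Cu 1 Ox.
  have dn := dN 1.
  have dp := classC_derivable 1 (classC_partial 0 (Cu 2)) Ox.
  have dq := classC_derivable 1 (classC_partial 1 (Cu 2)) Ox.
  have d00 := classC_derivable 1 (C 0 0) Ox.
  have d01 := classC_derivable 1 (C 0 1) Ox.
  have d10 := classC_derivable 1 (C 1 0) Ox.
  have d11 := classC_derivable 1 (C 1 1) Ox.
  by rewrite /raise /dlntilt; derive_poly.
have e00_1 : partial 1 (partial 0 p) x = partial 0 (partial 1 p) x.
  exact: (partial_comm oOm 1 0 (classC_partial 0 (Cu 3)) Ox).
have e11_0 : partial 0 (partial 1 q) x = partial 1 (partial 0 q) x.
  exact: (partial_comm oOm 0 1 (classC_partial 1 (Cu 3)) Ox).
have sym y : Om y -> partial 0 q y = partial 1 p y.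
  by move=> Oy; exact: (partial_comm oOm 0 1 (Cu 2) Oy).
have e01_0 : partial 0 (partial 0 q) x = partial 0 (partial 1 p) x.
  exact: (partial_eq oOm 0 sym Ox).
have e01_1 : partial 1 (partial 0 q) x = partial 1 (partial 1 p) x.
  exact: (partial_eq oOm 1 sym Ox).
have e01 := sym x Ox.
have E := translating_equation oOm Cu tr Ox.
have E0 := derived_translating_equation 0 Ox.
have E1 := derived_translating_equation 1 Ox.
rewrite sum_ord2; apply: etrans (congr2 +%R (is_partialE dV0) (is_partialE dV1)) _ => {dV0 dV1}.
rewrite (sqnorm_second_form_graph Ox) sum_ord2222 /sqnorm_covector sum_ord2 /raise /dlntilt /cometric /=.
move: (weight u x) (graph_det_neq0 u x) E E0 E1 => S; rewrite /graph_det.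
move: e01 e01_0 e01_1 e00_1 e11_0; clear.
generalize (p x) (q x) (partial 0 p x) (partial 0 q x) (partial 1 p x)
  (partial 1 q x) (partial 0 (partial 0 p) x) (partial 0 (partial 0 q) x)
  (partial 0 (partial 1 p) x) (partial 0 (partial 1 q) x)
  (partial 1 (partial 0 p) x) (partial 1 (partial 0 q) x)
  (partial 1 (partial 1 p) x) (partial 1 (partial 1 q) x) => a b r s' s t.
(* The symmetries leave the second derivatives [r], [s], [t] and four third
   derivatives. *)
move=> d000 _ d001 _ _ _ d011 d111 -> -> -> -> ->.
pose g := 1 + a ^+ 2 + b ^+ 2; rewrite -/g => g0 E E0 E1.
pose T := (1 + b ^+ 2) * r - a * b * (s + s) + (1 + a ^+ 2) * t.
pose T0 := 2 * b * s * r + (1 + b ^+ 2) * d000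
  - (r * b + a * s) * (s + s) - a * b * (d001 + d001)
  + 2 * a * r * t + (1 + a ^+ 2) * d011.
pose T1 := 2 * b * t * r + (1 + b ^+ 2) * d001
  - (s * b + a * t) * (s + s) - a * b * (d011 + d011)
  + 2 * a * s * t + (1 + a ^+ 2) * d111.
pose e0 := T0 - 2 * (a * r + b * s).
pose e1 := T1 - 2 * (a * s + b * t).
pose h := a * (a * r + b * s) + b * (a * s + b * t).
pose c := T - g.
(* Here [c], [e0] and [e1] are the defects in the translating equation and in its
   two derivatives.  The coefficients come from the Cayley-Hamilton theorem for
   the product of the Hessian of [u] with the adjugate of the metric, which
   expresses the quadratic terms in the Hessian by its trace [T], by [r + t] and
   [h], and by the determinant of the Hessian, whose contributions cancel. *)
apply/eqP; rewrite -subr_eq0; apply/eqP.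
transitivity (- (S / g ^+ 3 * (c * (g + g * (r + t) - 4 * h - 2 * g - c)
                               + g * (a * e0 + b * e1)))).
  rewrite /h /e0 /e1 /c /T /T0 /T1; move: g0; rewrite /g => g0.
  by field.
have -> : c = 0 by rewrite /c /T E subrr.
have -> : e0 = 0 by rewrite /e0 /T0 E0 subrr.
have -> : e1 = 0 by rewrite /e1 /T1 E1 subrr.
ring.
Qed.

End TiltJacobiField.

(** * The stability inequality *)

Section Stability.
Context {R : realType}.
Variables (Om : set (R * R)) (u : R * R -> R).
Hypotheses (oOm : open Om) (Cu : forall n, classC Om n u).
Local Notation X := (graph_map u).
Local Notation p := (partial 0 u).
Local Notation q := (partial 1 u).
Implicit Types (i j : 'I_2) (x : R * R).

Lemma classC_slope n i : classC Om n (partial i u).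
Proof. exact: classC_partial (Cu n.+1). Qed.

Lemma classC_graph_det n : classC Om n (graph_det u).
Proof.
apply: classCD => //; last exact/classCX/classC_slope.
by apply: classCD => //; [exact: classC_cst|exact/classCX/classC_slope].
Qed.

Lemma classC_tilt n : classC Om n (tilt u).
Proof.
apply: (classC_inv_sqrt oOm); last exact: classC_graph_det.
by move=> x _; exact: graph_det_gt0.
Qed.

Lemma classC_inv_graph_det n : classC Om n (fun x => (graph_det u x)^-1).
Proof.
apply: (classC_eq oOm) (classCX oOm 2 (classC_tilt n)) => x _.
by rewrite tilt_sqr.
Qed.

Lemma classC_weight n : classC Om n (weight u).
Proof.
apply: classCM => //; first exact: classC_expR.
apply: (classC_eq oOm) (classCM oOm (classC_graph_det n) (classC_tilt n)) => x _.
have s0 : Num.sqrt (graph_det u x) != 0 by rewrite gt_eqF // sqrtr_gt0 graph_det_gt0.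
rewrite /tilt -[X in X / _](sqr_sqrtr (ltW (graph_det_gt0 u x))).
by rewrite expr2 mulfK.
Qed.

Lemma classC_raise n (xi : 'I_2 -> R * R -> R) i :
  (forall j, classC Om n (xi j)) -> classC Om n (raise u xi i).
Proof.
move=> Cxi; apply: classCB => //; apply: classCM => //;
  last exact: classC_inv_graph_det.
apply: classCM => //; first exact: classC_slope.
by apply: classCD => //; apply: classCM => //; exact: classC_slope.
Qed.

Lemma classC_weighted_raise n (xi : 'I_2 -> R * R -> R) i :
  (forall j, classC Om n (xi j)) ->
  classC Om n (fun y => weight u y * raise u xi i y).
Proof.
move=> Cxi; exact (classCM oOm (classC_weight n) (classC_raise i Cxi)).
Qed.

Lemma classC_dlntilt n j : classC Om n (dlntilt u j).
Proof.
apply: classCN => //; apply: classCM => //; last exact: classC_inv_graph_det.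
by apply: classCD => //; apply: classCM => //; do ?apply: classC_partial;
  exact: Cu.
Qed.

Lemma sqnorm_covector_ge0 xi x : 0 <= sqnorm_covector u xi x.
Proof.
have -> : sqnorm_covector u xi x = (graph_det u x)^-1 *
    (xi 0 x ^+ 2 + xi 1 x ^+ 2 + (q x * xi 0 x - p x * xi 1 x) ^+ 2).
  rewrite /sqnorm_covector sum_ord2 /raise; have := graph_det_neq0 u x.
  rewrite /graph_det; move: (xi 0 x) (xi 1 x) => a b.
  by partials_to_vars => W0; field.
apply: mulr_ge0; first by rewrite invr_ge0 ltW // graph_det_gt0.
by rewrite !addr_ge0 // sqr_ge0.
Qed.

Variable f : R * R -> R.
Hypothesis Cf : forall n, classC Om n f.

Let df i := partial i f.

Lemma surface_grad_graph x : Om x -> surface_grad X f x =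
  \row_k [:: raise u df 0 x; raise u df 1 x;
             p x * raise u df 0 x + q x * raise u df 1 x]`_k.
Proof.
move=> Ox.
have -> : surface_grad X f x = \sum_(i < 2) \sum_(j < 2)
    (cometric u i j x * partial i f x) *:
      (\row_(k < 3) [:: (axis j).1; (axis j).2; partial j u x]`_k).
  apply: eq_bigr => i _; apply: eq_bigr => j _.
  congr (_ * _ *: _); first exact: (inv_metric_graph Cu).
  exact: (partial_graph Cu).
rewrite sum_ord22 /cometric /axis /raise /df /=.
have := graph_det_neq0 u x; rewrite /graph_det; partials_to_vars => W0.
apply/rowP => k; rewrite !mxE.
by case: k => [[|[|[|?]]]] lt //=; field.
Qed.

Lemma drift_laplacian_divergence x : Om x ->
  \sum_(i < 2) partial i (fun y => weight u y * raise u df i y) x =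
  weight u x * (laplacian X f x + dot e3 (surface_grad X f x)).
Proof.
move=> Ox; apply: (weighted_divergence oOm Cu) Ox => [i|y Oy].
  by apply: classC_raise => j; exact: classC_partial.
exact: surface_grad_graph.
Qed.

(** The vector field [f^2 grad (ln (f / w))] times the weight, in a form that makes
    sense where [f] vanishes. *)
Definition stability_flux i x : R :=
  f x * (weight u x * raise u df i x)
  - f x ^+ 2 * (weight u x * raise u (dlntilt u) i x).

Lemma classC_stability_flux n i : classC Om n (stability_flux i).
Proof.
have CZ : classC Om n (fun y => weight u y * raise u df i y).
  by apply: classC_weighted_raise => j; exact: classC_partial.
have CB := classC_weighted_raise i (classC_dlntilt n).
exact (classCB oOm (classCM oOm (Cf n) CZ) (classCM oOm (classCX oOm 2 (Cf n)) CB)).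
Qed.

Let residual j x := df j x - f x * dlntilt u j x.

(** Expanding the divergence of [f grad f - f^2 grad ln w], the second order terms
    give [f L f] by [drift_laplacian_divergence] and [jacobi_tilt], and the first
    order terms complete the square [|d f - f d ln w|^2]. *)
Lemma stability_identity x : translating Om X -> Om x ->
  f x * stability_operator X f x * weight u x =
  \sum_(i < 2) partial i (stability_flux i) x
    - weight u x * sqnorm_covector u residual x.
Proof.
move=> tr Ox.
have dflux i : partial i (stability_flux i) x =
    f x * partial i (fun y => weight u y * raise u df i y) x
    + weight u x * raise u df i x * df i x
    - (f x ^+ 2 * partial i (fun y => weight u y * raise u (dlntilt u) i y) x
       + weight u x * raise u (dlntilt u) i x * (2 * f x * df i x)).
  have dfx := classC_derivable i (Cf 1) Ox.
  have CZ : classC Om 1 (fun y => weight u y * raise u df i y).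
    by apply: classC_weighted_raise => j; exact: classC_partial.
  have CB := classC_weighted_raise i (classC_dlntilt 1).
  have dZ := classC_derivable i CZ Ox.
  have dB := classC_derivable i CB Ox.
  have dfB := is_derive_mul (is_derive_sqr dfx) dB.
  exact: is_partialE (is_derive_add (is_derive_mul dfx dZ) (is_derive_opp dfB)).
have L := drift_laplacian_divergence Ox; rewrite sum_ord2 in L.
have J := jacobi_tilt oOm Cu tr Ox; rewrite sum_ord2 in J.
have {}J : weight u x * sqnorm_second_form X x = - (
      partial 0 (fun y => weight u y * raise u (dlntilt u) 0 y) x +
      partial 1 (fun y => weight u y * raise u (dlntilt u) 1 y) x)
    - weight u x * sqnorm_covector u (dlntilt u) x.
  rewrite J; move: (weight u x) (sqnorm_second_form X x) (sqnorm_covector _ _ _).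
  by move=> w s m; ring.
rewrite (eq_bigr _ (fun i _ => dflux i)) sum_ord2 /stability_operator.
move: L J; rewrite /sqnorm_covector !sum_ord2 /residual /raise /df.
move: (weight u x) (laplacian X f x) (dot e3 _) (sqnorm_second_form X x) (f x)
  (dlntilt u 0 x) (dlntilt u 1 x) (graph_det u x)^-1 => w l g s c m0 m1 N.
partials_to_vars => L J.
have -> : c * (l + s * c + g) * w = c * (w * (l + g)) + c ^+ 2 * (w * s) by ring.
by rewrite -L J; ring.
Qed.

Lemma surface_integrand_graph x : Om x ->
  f x * stability_operator X f x * expR (X x 0 2) * area_density X x =
  f x * stability_operator X f x * weight u x.
Proof.
move=> Ox; rewrite (area_density_graph Cu Ox) /weight mulrA.
by congr (_ * expR _ * _); rewrite mxE.
Qed.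

Lemma stability_integral_le0 (K : set (R * R)) : translating Om X ->
  compact K -> K `<=` Om -> (forall x, Om x -> ~ K x -> f x = 0) ->
  (surface_integral Om X
     (fun x => f x * stability_operator X f x * expR (X x 0 2))%R <= 0)%E.
Proof.
move=> tr cK KOm fK.
apply: (integral_le_divergence (K := K) (Y := stability_flux)) => //.
- by move=> i; exact: classC_stability_flux.
- by move=> i x Ox nKx; rewrite /stability_flux (fK x Ox nKx) expr0n !mul0r subrr.
- by move=> x Ox nKx; rewrite (fK x Ox nKx) !mul0r.
- have Cdiv : classC Om 0 (fun x => \sum_(i < 2) partial i (stability_flux i) x).
    by apply: classC_sum2 => // i; exact: classC_partial (classC_stability_flux 1 i).
  have Cres j : classC Om 0 (residual j).
    exact (classCB oOm (classC_partial j (Cf 1)) (classCM oOm (Cf 0) (classC_dlntilt 0 j))).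
  have Csq : classC Om 0 (sqnorm_covector u residual).
    apply: classC_sum2 => // i.
    exact (classCM oOm (classC_raise i Cres) (Cres i)).
  apply: (classC_eq oOm) (classCB oOm Cdiv (classCM oOm (classC_weight 0) Csq)) => x Ox.
  by rewrite (surface_integrand_graph Ox) stability_identity.
- move=> x Ox; rewrite (surface_integrand_graph Ox) stability_identity //.
  rewrite gerBl mulr_ge0 ?sqnorm_covector_ge0 //.
  by rewrite /weight mulr_ge0 ?expR_ge0 ?sqrtr_ge0.
Qed.

End Stability.

Theorem theorem2p5 (R : realType) (Omega : set (R * R)) (u : R * R -> R)
    (hu : translating_graph Omega u) :
  L_stable Omega (graph_map u).
Proof.
case: hu => -[oOm _ _] su tr eta seta [K [cK KS etaK]] /=.
have Cu n : classC Omega n u by exact: smooth_classC.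
have Cf n : classC Omega n (eta \o graph_map u) by exact: smooth_classC.
(* The projection to the parameter plane inverts [graph_map u], so it carries the
   compact support on the surface to a compact subset of [Omega]. *)
pose pi (v : 'rV[R]_3) : R * R := (v 0 0, v 0 1).
have piX x : pi (graph_map u x) = x by rewrite /pi !mxE /= -surjective_pairing.
apply: (@stability_integral_le0 _ _ _ oOm Cu _ Cf (pi @` K) tr).
- apply: continuous_compact => //; apply: continuous_subspaceT => v.
  exact: (cvg_pair (@coord_continuous R 1 3 0 0 v) (@coord_continuous R 1 3 0 1 v)).
- by move=> _ [v /KS [x Ox <-] <-]; rewrite piX.
- move=> x Ox nKx; apply: etaK; first by exists x.
  by move=> KX; apply: nKx; exists (graph_map u x).
Qed.
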